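(* Let $m\ge1$ and let $\Phi^{(m)}(x,y)$ be the generating function of intervals of the $m$-Tamari lattices, where $y$ counts the size of the objects and $x$ the number of touching points of the lowest path (the number of contacts with the line $y=\frac{x}{m}$ after the starting point). Then $$\Phi^{(m)}=\mathrm{B}^{(m)}(\Phi^{(m)},\dots,\Phi^{(m)})+1,$$ where $\mathrm{B}^{(m)}$ is the $(m+1)$-linear operator defined by $$\mathrm{B}^{(m)}(f,g_1,\dots,g_m)=f\succ xy\prec_\delta\bigl(g_1\prec_\delta(\cdots\prec_\delta(g_{m-1}\prec_\delta g_m))\cdots\bigr).$$
   Context: Operations on power series in $y$ with polynomial coefficients in $x$: $f\succ g:=fg$ and $f\prec_\delta g:=f\,\Delta(g)$, with $\Delta(g):=\frac{x\,g(x,y)-g(1,y)}{x-1}$. Thus $\mathrm{B}^{(m)}(f,g_1,\dots,g_m)=xy\,f\,\Delta(g_1\Delta(g_2\Delta(\cdots\Delta(g_m)\cdots)))$. An $m$-ballot path of size $n$ is a lattice path from $(0,0)$ to $(nm,n)$ made of vertical steps $(0,1)$ (letter $1$) and horizontal steps $(1,0)$ (letter $0$) which stays weakly above the line $y=\frac{x}{m}$. A nonempty $m$-ballot path is primitive if it touches this line only at its two endpoints. A rotation of an $m$-ballot path takes a horizontal step $0$ that is immediately followed by a (translated) primitive path $u$ and exchanges them, replacing the factor $0u$ by $u0$. The $m$-Tamari lattice $\mathcal{T}_n^{(m)}$ is the set of $m$-ballot paths of size $n$ ordered by the reflexive transitive closure of rotation (a rotated path is greater). $\Phi^{(m)}(x,y)$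 is the sum of $x^{c(W_1)}y^n$ over all $n\ge0$ and all intervals $[W_1,W_2]$ (pairs $W_1\le W_2$) of $\mathcal{T}_n^{(m)}$, where $c(W_1)$ is the number of contacts of $W_1$ with the line $y=\frac xm$, not counting the starting point; the unique interval of size $0$ contributes $1$. *)

(* Defs.v *)
From HB Require Import structures.
From mathcomp Require Import all_boot all_order all_algebra.
Set Implicit Arguments.
Unset Strict Implicit.
Unset Printing Implicit Defensive.
Import GRing.Theory.
Local Open Scope ring_scope.

(** * m-ballot paths and the m-Tamari order *)

(** A path is the word of its steps: [true] is the vertical step (letter 1),
    [false] the horizontal step (letter 0).  After [i] steps of [w] the path is
    at the point [(hpos w i, vpos w i)]. *)
Definition hpos (w : seq bool) (i : nat) : nat := count_mem false (take i w).
Definition vpos (w : seq bool) (i : nat) : nat := count_mem true (take i w).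

(** Lattice points suffice to compare a path with the line [y = x / m]: a path
    weakly above the line can meet it only at lattice points. *)
Definition above_line (m : nat) (w : seq bool) (i : nat) : bool :=
  (hpos w i <= m * vpos w i)%N.
Definition on_line (m : nat) (w : seq bool) (i : nat) : bool :=
  hpos w i == (m * vpos w i)%N.

Definition is_mballot (m n : nat) (w : seq bool) : bool :=
  [&& count_mem true w == n, count_mem false w == (n * m)%N
    & [forall i : 'I_(size w).+1, above_line m w i]].

Definition primitive (m : nat) (u : seq bool) : bool :=
  [&& u != [::], is_mballot m (count_mem true u) u
    & [forall i : 'I_(size u), (0 < i)%N ==> ~~ on_line m u i]].

Definition contacts (m : nat) (w : seq bool) : nat :=
  count (on_line m w) (iota 1 (size w)).

Definition rotation (m : nat) (w w' : seq bool) : bool :=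
  [exists i : 'I_(size w), exists j : 'I_(size w),
    let a := take i w in
    let u := take j (drop i.+1 w) in
    let b := drop j (drop i.+1 w) in
    [&& w == a ++ false :: u ++ b, primitive m u & w' == a ++ u ++ false :: b]].

Lemma rotationP (m : nat) (w w' : seq bool) :
  reflect (exists a u b, [/\ w = a ++ false :: u ++ b, primitive m u
                           & w' = a ++ u ++ false :: b])
          (rotation m w w').
Proof.
apply: (iffP existsP) => [[i /existsP[j /and3P[/eqP ew pu /eqP ew']]]|].
  by do 3!eexists; split; [exact: ew | exact: pu | exact: ew'].
case=> a [u [b [-> pu ->]]].
have ia : (size a < size (a ++ false :: u ++ b))%N.
  by rewrite size_cat /= addnS ltnS leq_addr.
have ju : (size u < size (a ++ false :: u ++ b))%N.
  by rewrite size_cat /= size_cat addnS ltnS addnCA leq_addr.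
exists (Ordinal ia); apply/existsP; exists (Ordinal ju) => /=.
have -> : drop (size a).+1 (a ++ false :: u ++ b) = u ++ b.
  by rewrite -cat_rcons -(size_rcons a false) drop_size_cat.
by rewrite !take_size_cat // drop_size_cat // !eqxx pu.
Qed.

Record mballot (m n : nat) := MBallot {
  mbword :> (n + n * m).-tuple bool;
  _ : is_mballot m n mbword }.

HB.instance Definition _ m n := [isSub for @mbword m n].
HB.instance Definition _ m n := [Countable of mballot m n by <:].
HB.instance Definition _ m n := [Finite of mballot m n by <:].

Definition tamari_le (m n : nat) : rel (mballot m n) :=
  connect (fun W1 W2 : mballot m n => rotation m W1 W2).

(** * Power series in y with coefficients in Z[x] *)

(** [f n] is the coefficient of [y ^ n]. *)
Definition series := nat -> {poly int}.

Definition sone : series := fun n => (n == 0%N)%:R.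
Definition sxy : series := fun n => if n == 1%N then 'X else 0.
Definition sadd (f g : series) : series := fun n => f n + g n.
Definition smul (f g : series) : series :=
  fun n => \sum_(i < n.+1) f i * g (n - i)%N.

(** The division by [x - 1] is exact, see [DeltaE]. *)
Definition Delta (g : series) : series :=
  fun n => ('X * g n - (g n).[1]%:P) %/ ('X - 1).

Lemma DeltaE (g : series) (n : nat) :
  ('X - 1) * Delta g n = 'X * g n - (g n).[1]%:P.
Proof.
rewrite /Delta mulrC -polyC1 Pdiv.IdomainUnit.divpK ?lead_coefXsubC ?unitr1 //.
by rewrite dvdp_XsubCl; apply/rootP; rewrite !hornerE subrr.
Qed.

Definition ssucc (f g : series) : series := smul f g.
Definition sprec (f g : series) : series := smul f (Delta g).

(** [g_1 < (g_2 < ... (g_(m-1) < g_m))] for [<] the operation [sprec]; the value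
    on the empty sequence is a default, never used when [1 <= m]. *)
Fixpoint sprec_nest (gs : seq series) : series :=
  match gs with
  | [::] => fun=> 0
  | [:: g] => g
  | g :: gs' => sprec g (sprec_nest gs')
  end.

(** The bracketing is immaterial: both readings are [x y f Delta (...)]. *)
Definition Bop (m : nat) (f : series) (gs : m.-tuple series) : series :=
  ssucc f (sprec sxy (sprec_nest gs)).

(** In a pair [I] with [tamari_le I.1 I.2], [I.1] is the lowest path. *)
Definition Phi (m : nat) : series :=
  fun n => \sum_(I : mballot m n * mballot m n | tamari_le I.1 I.2)
             'X^(contacts m I.1).

(* Main.v *)
Require Import Defs.
From mathcomp Require Import all_boot all_order all_algebra.
From Stdlib Require Import Relation_Operators.
From mathcomp Require Import boolp zify.

Set Implicit Arguments.
Unset Strict Implicit.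
Unset Printing Implicit Defensive.
Import GRing.Theory.

(** Measure the height of a lattice point above the line y = x / m by its level
    m * vpos - hpos: a vertical step adds m, a horizontal step removes 1, and a
    path may start at any level k >= 0.  Call a word k-ballot if it leads from
    level k to level 0 without going below 0; the m-ballot paths are the
    0-ballot words.  Rotations make sense on all words and preserve the
    k-ballot ones.  Let G_k be the series of the pairs w <= w' of k-ballot words
    of the same size, with x marking the contacts with level 0 that follow the
    first one, so that G_0 is Phi.  Two decompositions determine G_k.

    A nonempty m-ballot path is 1 w with w an m-ballot word.  No rotation can
    involve a leading 1, so 1 w <= 1 w' iff w <= w'; hence the part of Phi of
    positive size is x y G_m.

    A (k+1)-ballot word is uniquely v 0 C, where v is k-ballot, C is 0-ballot
    and the displayed 0 is the step that first reaches level 0.  Then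
    v 0 C <= v' 0 C' iff C = A D with A and D both 0-ballot, v A <= v' and
    D <= C' ([rotations_last_descent]).  The displayed 0 can indeed be moved
    through A, one primitive factor at a time ([rotations_past]).  Conversely
    a rotation out of v 0 C acts inside v, acts inside C, or moves a primitive
    factor from C to v, and in all three cases the factorisation of C can be
    carried along.  So a pair at level k+1 amounts to a pair (D, C') counted by
    G_0 and a pair (v A, v') counted by G_k with one contact of v A marked, the
    one at the end of v.  If v A has e + 1 contacts, the part after the mark
    contributes one of x^0, ..., x^e, and x^0 + ... + x^e is Delta(x^e).  Hence
    G_(k+1) = Phi * Delta(G_k) ([interval_series_descent]), and iterating this
    m times in x y G_m gives the nested operator of the theorem. *)

(** * Words and levels *)

(** [None] means that the word goes below level 0. *)
Fixpoint level (m k : nat) (w : seq bool) : option nat :=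
  match w with
  | [::] => Some k
  | true :: w' => level m (k + m) w'
  | false :: w' => if k is k'.+1 then level m k' w' else None
  end.

Lemma level_cat (m k : nat) (a b : seq bool) :
  level m k (a ++ b) = obind (fun l => level m l b) (level m k a).
Proof. by elim: a k => [|[] a IHa] [|k] //=. Qed.

Lemma level_catP (m k l : nat) (a b : seq bool) :
  level m k (a ++ b) = Some l ->
  exists2 j, level m k a = Some j & level m j b = Some l.
Proof. by rewrite level_cat; case: (level m k a) => //= j e; exists j. Qed.

(** Lifting the starting point keeps a path above level 0; only this direction
    holds, since a lifted path has more room below. *)
Lemma level_shift (m j k l : nat) (w : seq bool) :
  level m k w = Some l -> level m (k + j) w = Some (l + j).
Proof.
elim: w k => [|[] w IHw] /= k; first by case=> ->.
  by move/IHw; rewrite addnAC.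
by case: k => // k /IHw.
Qed.

(** The final level is the initial one corrected by the two kinds of steps;
    this links levels with the coordinates [hpos] and [vpos]. *)
Lemma level_count (m k l : nat) (w : seq bool) :
  level m k w = Some l ->
  k + m * count_mem true w = l + count_mem false w.
Proof.
elim: w k => [|[] w IHw] /= k; first by case=> ->; rewrite muln0.
  by move/IHw; rewrite mulnDr muln1 addnA add0n.
by case: k => // k /IHw; rewrite add0n addSn => ->; rewrite add1n addnS.
Qed.

Lemma level_size (m k n : nat) (w : seq bool) :
  level m k w = Some 0 -> count_mem true w = n -> size w = n + (k + n * m).
Proof.
move=> /level_count e <-; rewrite mulnC e add0n.
by rewrite -(count_predC (pred1 true) w); congr (_ + _); apply: eq_count; case.
Qed.

Lemma levelP (m k : nat) (w : seq bool) :
  reflect (forall i, i <= size w ->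
             count_mem false (take i w) <= k + m * count_mem true (take i w))
          (level m k w : bool).
Proof.
apply: (iffP idP) => [|le_w].
  move=> lw i _; move: lw; rewrite -{1}(cat_take_drop i w) level_cat.
  case e: (level m k (take i w)) => [l|] // _; move: (level_count e); lia.
elim: w k le_w => [|[] w IHw] k //= le_w.
  by apply: IHw => i lei; move: (le_w i.+1 lei) => /=; lia.
case: k le_w => [|k] le_w; first by move: (le_w 1 isT); rewrite /= take0 /=; lia.
by apply: IHw => i lei; move: (le_w i.+1 lei) => /=; lia.
Qed.

Lemma is_mballotE (m n : nat) (w : seq bool) :
  is_mballot m n w = (level m 0 w == Some 0) && (count_mem true w == n).
Proof.
apply/idP/andP => [/and3P[/eqP en /eqP ef /forallP le_w]|[/eqP e0 /eqP en]].
  rewrite en; split=> //; have: level m 0 w.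
    apply/levelP => i lei; rewrite -ltnS in lei.
    exact: (le_w (Ordinal lei)).
  by case e: (level m 0 w) => [l|] // _; move: (level_count e) => ?; apply/eqP; congr Some; lia.
apply/and3P; split; first exact/eqP.
  by apply/eqP; move: (level_count e0); rewrite en; lia.
have lw: level m 0 w by rewrite e0.
apply/forallP => i; move/levelP: lw => /(_ i (ltn_ord i)).
by rewrite add0n.
Qed.

(** Two factorisations of one word are compared by the position of their
    cuts; all the overlap analysis of rotations goes through this dichotomy. *)
Lemma cat_cat (T : Type) (a b c d : seq T) :
  a ++ b = c ++ d ->
  (exists2 e, c = a ++ e & b = e ++ d) \/
  (exists x e, a = c ++ x :: e /\ d = x :: e ++ b).
Proof.
elim: a c => [|x a IHa] [|y c] /=; first by left; exists [::].
- by move=> ->; left; exists (y :: c).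
- by move=> <-; right; exists x, a.
case=> -> /IHa[[e -> ->]|[z [e [-> ->]]]]; first by left; exists e.
by right; exists z, e.
Qed.

(** Levels drop by one at a time, so a path from level k + 1 to level 0 has a
    first arrival at level 0.  Up to there it stays at levels >= 1, that is, it
    is a path from k to 0 shifted by one. *)
Lemma last_descent_ex (m k : nat) (w : seq bool) :
  level m k.+1 w = Some 0 ->
  exists v C, [/\ w = v ++ false :: C, level m k v = Some 0
                & level m 0 C = Some 0].
Proof.
elim: w k => [|[] w IHw] //= k.
  by rewrite addSn => /IHw[v [C [-> ? ?]]]; exists (true :: v), C.
case: k => [|k]; first by exists [::], w.
by case/IHw=> [v [C [-> ? ?]]]; exists (false :: v), C.
Qed.

(** If two such cuts differed, one of the prefixes would extend the other by a
    horizontal step taken at level 0. *)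
Lemma last_descent_uniq (m k : nat) (v v' C C' : seq bool) :
  level m k v = Some 0 -> level m k v' = Some 0 ->
  v ++ false :: C = v' ++ false :: C' -> v = v' /\ C = C'.
Proof.
move=> lv lv' /cat_cat[[[|x e] ev /=]|[x [e [ev]]]].
- by case=> ->; rewrite ev cats0.
- by case=> ex _; move: lv'; rewrite ev -ex level_cat lv.
- by case=> ex _; move: lv; rewrite ev -ex level_cat lv'.
Qed.

Lemma last_descent_level (m k : nat) (v C : seq bool) :
  level m k v = Some 0 -> level m k.+1 (v ++ false :: C) = level m 0 C.
Proof.
by move=> /(level_shift 1); rewrite addn1 level_cat => ->.
Qed.

(** The primitive factor at the head of a ballot path: after the first vertical
    step the path is at level m, and the first return to 0 is the last descent
    of an m-ballot word. *)
Lemma first_primitive (m : nat) (A : seq bool) :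
  0 < m -> level m 0 A = Some 0 -> A != [::] ->
  exists v B, [/\ A = true :: v ++ false :: B, level m m.-1 v = Some 0
                & level m 0 B = Some 0].
Proof.
case: m A => // m [|[] A] //= _ /last_descent_ex[v [C [-> ? ?]]] _.
by exists v, C.
Qed.

(** With this description, primitive paths are handled without mentioning the
    positions where they avoid the line. *)
Lemma primitiveP (m : nat) (u : seq bool) : 0 < m ->
  reflect (exists2 v, level m m.-1 v = Some 0 & u = true :: rcons v false)
          (primitive m u).
Proof.
move=> m0; rewrite /primitive is_mballotE eqxx andbT.
apply: (iffP and3P) => [[u0 /eqP lu /forallP off]|[v lv ->]].
  have [v [B [eu lv lB]]] := first_primitive m0 lu u0.
  exists v => //; case: B => [|x B] in eu lB *; first by rewrite eu cats1.
  have ltu: (size v).+2 < size u by rewrite eu /= size_cat /=; lia.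
  exfalso; move: (off (Ordinal ltu)) => /=; rewrite /on_line /hpos /vpos eu.
  rewrite -cat_rcons /= take_size_cat ?size_rcons //= -cats1 !count_cat /=.
  move: (level_count lv) => e /negP[]; apply/eqP; rewrite !addn0 mulnDr muln1.
  by rewrite add0n in e; rewrite add0n -e addn1 -addSn prednK.
split=> //.
  by rewrite /= add0n -(prednK m0) -cats1 prednK // -{2}(prednK m0) last_descent_level.
apply/forallP => [[[|i] /= lti]] //; rewrite size_rcons !ltnS in lti.
rewrite /on_line /hpos /vpos /= -cats1 takel_cat //.
move: lv; rewrite -{1}(cat_take_drop i v) => /level_catP[j /level_count e _].
apply/eqP => E; move: E e; rewrite add0n mulnDr muln1.
by move: (count_mem true (take i v)) (count_mem false (take i v)) => c d; lia.
Qed.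

Lemma level_primitive (m k : nat) (u : seq bool) :
  primitive m u -> level m k u = Some k.
Proof.
by case/and3P=> _; rewrite is_mballotE eqxx andbT => /eqP /(level_shift k) -> _.
Qed.

Lemma level_rotation (m k l : nat) (w w' : seq bool) :
  rotation m w w' -> level m k w = Some l -> level m k w' = Some l.
Proof.
case/rotationP=> [a [u [b [-> pu ->]]]] /level_catP[[|j] //= ea].
by rewrite !level_cat ea /= !level_cat !(level_primitive _ pu).
Qed.

(** * The order generated by rotations *)

(** The order on arbitrary words.  The closure adds steps on the left, as the
    analysis of intervals peels rotations off the lower word. *)
Notation rotations m := (clos_refl_trans_1n (seq bool) (rotation m)).

Lemma rotations_trans (m : nat) (w1 w2 w3 : seq bool) :
  rotations m w1 w2 -> rotations m w2 w3 -> rotations m w1 w3.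
Proof. by elim=> // a b c ab _ IH /IH; apply: rt1n_trans. Qed.

Lemma rotation_cat (m : nat) (a b w w' : seq bool) :
  rotation m w w' -> rotation m (a ++ w ++ b) (a ++ w' ++ b).
Proof.
case/rotationP=> [c [u [d [-> pu ->]]]]; apply/rotationP.
by exists (a ++ c), u, (d ++ b); split; rewrite // -!catA /= -?catA.
Qed.

Lemma rotations_cat (m : nat) (a b w w' : seq bool) :
  rotations m w w' -> rotations m (a ++ w ++ b) (a ++ w' ++ b).
Proof.
elim=> [c|c d e cd _ IH]; first exact: rt1n_refl.
exact: rt1n_trans (rotation_cat _ _ cd) IH.
Qed.

Lemma level_rotations (m k l : nat) (w w' : seq bool) :
  rotations m w w' -> level m k w = Some l -> level m k w' = Some l.
Proof. by elim=> // a b c /level_rotation ab _ IH /ab. Qed.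

Lemma count_rotations (m : nat) (w w' : seq bool) :
  rotations m w w' -> count_mem true w' = count_mem true w.
Proof.
elim=> // a b c /rotationP[d [u [e [-> _ ->]]]] _ ->.
by rewrite !count_cat /= count_cat.
Qed.

(** A rotation starts with a horizontal step, which cannot be the leading
    vertical step. *)
Lemma rotations_up (m : nat) (w w' : seq bool) :
  rotations m (true :: w) (true :: w') <-> rotations m w w'.
Proof.
split=> [|ww']; last first.
  by move: (rotations_cat [:: true] [::] ww'); rewrite /= !cats0.
move E: (true :: w) => v; move E': (true :: w') => v' vv'.
elim: vv' w w' E E' => [x|x y z /rotationP[a [u [b [ex pu ey]]]] _ IH] w w' ew ew'.
  by move: ew; rewrite -ew' => -[->]; apply: rt1n_refl.
move: ex; rewrite -ew => {ew}; case: a ey => [|? a] //= ey [ea ->].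
rewrite -ea in ey; apply: rt1n_trans (IH _ _ (esym ey) ew').
by apply/rotationP; exists a, u, b.
Qed.

(** A horizontal step climbs over a ballot path by passing its primitive factors
    one after the other. *)
Lemma rotations_past (m : nat) (A D : seq bool) :
  0 < m -> level m 0 A = Some 0 -> rotations m (false :: A ++ D) (A ++ false :: D).
Proof.
move=> m0; have [n] := ubnP (size A); elim: n A => // n IHn A ltA lA.
have [->|A0] := eqVneq A [::]; first exact: rt1n_refl.
have [v [B [eA lv lB]]] := first_primitive m0 lA A0.
pose u := true :: rcons v false; have {}eA: A = u ++ B by rewrite eA /= cat_rcons.
have pu: primitive m u by apply/primitiveP => //; exists v.
apply: (rt1n_trans _ _ _ (u ++ false :: B ++ D)).
  by apply/rotationP; exists [::], u, (B ++ D); rewrite eA catA.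
have{lB IHn} := IHn B _ lB; rewrite eA size_cat /= in ltA.
rewrite eA -!catA => /(_ ltac:(lia)) /(rotations_cat u [::]).
by rewrite !cats0.
Qed.

(** The alternatives are the rotated 0 lying in [v], in [C], or being the
    separating step.  In the first one the primitive factor cannot overlap the
    separator: it starts at a level >= 1 of the whole word and never goes below
    its start, while the separator reaches level 0. *)
Lemma rotation_last_descent (m k : nat) (v C w : seq bool) :
  level m k v = Some 0 -> rotation m (v ++ false :: C) w ->
  [\/ exists2 v1, rotation m v v1 & w = v1 ++ false :: C,
      exists2 C1, rotation m C C1 & w = v ++ false :: C1
    | exists u C1, [/\ primitive m u, C = u ++ C1 & w = v ++ u ++ false :: C1]].
Proof.
move=> lv /rotationP[a [u [b [e pu ->]]]].
have [[[|x e1] ea /=]|[x [e1 [ev]]]] := cat_cat e.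
- by case=> ->; rewrite ea cats0; constructor 3; exists u, b.
- case=> ex eC; rewrite -ex in ea; constructor 2; exists (e1 ++ u ++ false :: b).
    by rewrite eC; apply/rotationP; exists e1, u, b.
  by rewrite ea -catA.
case=> ex; rewrite -{x}ex in ev * => /cat_cat[[e2 e1E bE]|[x [e2 [eu [ex _]]]]].
  rewrite ev e1E bE; constructor 1; exists (a ++ u ++ false :: e2).
    by apply/rotationP; exists a, u, e2.
  by rewrite -!catA /=.
(* The separator lies inside [u]: from the level [j] at which [u] starts, the
   word [e1] leads to 0, so [j = 0] and [u] itself goes below its start. *)
move: lv; rewrite ev => /level_catP[[|j] //= _ lj].
move: (level_primitive 0 pu); rewrite eu -ex => /level_catP[[|i] //= li _].
by move: (level_shift j li); rewrite add0n lj.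
Qed.

(** A cut at level 0 in the result of a rotation can be pulled back.  The moved
    primitive factor is lifted by one, so it lies at levels >= 1, and the cut
    cannot fall inside it. *)
Lemma rotation_to_cat (m : nat) (C A D : seq bool) :
  rotation m C (A ++ D) -> level m 0 C = Some 0 -> level m 0 A = Some 0 ->
  exists A' D', [/\ C = A' ++ D', level m 0 A' = Some 0,
                    rotations m A' A & rotations m D' D].
Proof.
move=> /rotationP[a [u [b [-> pu]]]] e /level_catP[[|l] // la _] lA.
case/esym/cat_cat: e => [[e eA]|[x [e [ea ->]]]]; last first.
  exists A, (x :: e ++ false :: u ++ b); split=> //.
  - by rewrite ea -catA.
  - exact: rt1n_refl.
  - apply: (rt1n_trans _ _ _ (x :: e ++ u ++ false :: b)); last exact: rt1n_refl.
    by apply/rotationP; exists (x :: e), u, b.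
move: lA; rewrite eA level_cat la /= => le.
case/cat_cat=> [[e' ee]|[x [e' [eu _]]]].
  move: le; rewrite ee level_cat (level_primitive _ pu) /=.
  case: e' ee => [|[] e'] //= ee le [->].
  exists (a ++ false :: u ++ e'), D; split; rewrite -?catA /= -?catA //.
  - by rewrite level_cat la /= level_cat (level_primitive _ pu).
  - apply: (rt1n_trans _ _ _ (a ++ u ++ false :: e')); last exact: rt1n_refl.
    by apply/rotationP; exists a, u, e'.
  - exact: rt1n_refl.
move: (level_primitive 0 pu); rewrite eu => /level_catP[j lj _].
by move: (level_shift l.+1 lj); rewrite add0n le addnS.
Qed.

(** The recursive description of intervals.  [A] is the part of [C] that the
    separating step must climb over to reach its position in the upper word. *)
Lemma rotations_last_descent (m k : nat) (v C v' C' : seq bool) :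
  0 < m -> level m k v = Some 0 -> level m 0 C = Some 0 ->
  level m k v' = Some 0 ->
  rotations m (v ++ false :: C) (v' ++ false :: C') <->
  exists A D, [/\ C = A ++ D, level m 0 A = Some 0, level m 0 D = Some 0,
                  rotations m (v ++ A) v' & rotations m D C'].
Proof.
move=> m0 lv lC lv'; split=> [|[A [D [-> lA lD vA DC]]]]; last first.
  apply: rotations_trans (_ : rotations m _ ((v ++ A) ++ false :: D)) _.
    by rewrite -catA; move: (rotations_cat v [::] (rotations_past D m0 lA)); rewrite !cats0.
  apply: rotations_trans (rotations_cat [::] (false :: D) vA) _.
  by move: (rotations_cat (v' ++ [:: false]) [::] DC); rewrite !cats0 -!catA.
move E: (v ++ _) => w; move E': (v' ++ _) => w' ww'.
elim: ww' v C E E' lv lC => [x|x y z xy _ IH] v C Ex Ez lv lC.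
  move: Ez; rewrite -Ex => /(last_descent_uniq lv' lv)[-> ->].
  by exists [::], C; split; rewrite ?cats0 //; apply: rt1n_refl.
move: xy; rewrite -Ex => {Ex} /(rotation_last_descent lv).
case=> [[v1 vv1 ey]|[C1 CC1 ey]|[u [C1 [pu eC ey]]]].
- have lv1 := level_rotation vv1 lv.
  have [A [D [-> lA lD v1A DC]]] := IH _ _ (esym ey) Ez lv1 lC.
  exists A, D; split=> //; apply: rt1n_trans v1A.
  exact: (rotation_cat [::] A).
- have lC1 := level_rotation CC1 lC.
  have [A [D [eC1 lA lD vA DC]]] := IH _ _ (esym ey) Ez lv lC1.
  rewrite {}eC1 in CC1.
  have [A' [D' [eC lA' AA' DD']]] := rotation_to_cat CC1 lC lA.
  exists A', D'; split=> //.
  + by move: lC; rewrite eC level_cat lA'.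
  + apply: rotations_trans vA; move: (rotations_cat v [::] AA').
    by rewrite !cats0.
  + exact: rotations_trans DD' DC.
(* The separator climbs over [u], which passes from [C] to the left factor. *)
have lu := level_primitive 0 pu.
have lC1: level m 0 C1 = Some 0 by move: lC; rewrite eC level_cat lu.
have lvu: level m k (v ++ u) = Some 0 by rewrite level_cat lv.
rewrite catA in ey.
have [A [D [eC1 lA lD vA DC]]] := IH _ _ (esym ey) Ez lvu lC1.
exists (u ++ A), D; split=> //.
- by rewrite eC eC1 catA.
- by rewrite level_cat lu.
- by rewrite catA.
Qed.


(** * Contacts *)

(** The positions at level 0, in increasing order, including the starting point
    when [k] is 0. *)
Fixpoint grounds (m k : nat) (w : seq bool) : seq nat :=
  nseq (k == 0) 0 ++
  match w with
  | [::] => [::]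
  | true :: w' => map S (grounds m (k + m) w')
  | false :: w' => if k is k'.+1 then map S (grounds m k' w') else [::]
  end.

Lemma mem_grounds (m k j : nat) (w : seq bool) :
  (j \in grounds m k w) = (j <= size w) && (level m k (take j w) == Some 0).
Proof.
elim: w k j => [|[] w IHw] k j /=; rewrite mem_cat mem_nseq.
- by rewrite in_nil orbF; case: k j => [|k] [|j].
- case: j => [|j]; rewrite ?(mem_map succn_inj) ?IHw /=.
    by rewrite lt0b -[0 \in _]negbK (_ : 0 \notin _) ?orbF;
       [case: k | apply/mapP => -[]].
  by rewrite andbF.
case: j => [|j]; case: k => [|k]; rewrite ?(mem_map succn_inj) ?IHw ?in_nil ?andbF //=.
by apply/mapP => -[].
Qed.

Lemma uniq_grounds (m k : nat) (w : seq bool) : uniq (grounds m k w).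
Proof.
have S0 s : (0 \notin map S s) by apply/mapP => -[].
elim: w k => [|[] w IHw] [|k] //=; rewrite ?S0 //= (map_inj_uniq succn_inj) //.
Qed.

(** A cut at level 0 is a contact of both factors, hence the correction. *)
Lemma size_grounds_cat (m k l : nat) (a b : seq bool) :
  level m k a = Some l ->
  size (grounds m k (a ++ b)) + (l == 0) =
  size (grounds m k a) + size (grounds m l b).
Proof.
elim: a k => [|[] a IHa] /= k.
- by case=> ->; rewrite cats0 size_nseq; lia.
- by move=> /IHa; rewrite !size_cat !size_map; lia.
case: k => // k /IHa; rewrite !size_cat !size_map; lia.
Qed.

Lemma size_grounds_gt0 (m k : nat) (w : seq bool) :
  level m k w = Some 0 -> 0 < size (grounds m k w).
Proof.
move=> lw; suff: size w \in grounds m k w by case: (grounds m k w).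
by rewrite mem_grounds take_size lw !eqxx leqnn.
Qed.

Lemma size_grounds_last_descent (m k : nat) (v C : seq bool) :
  level m k v = Some 0 ->
  size (grounds m k.+1 (v ++ false :: C)) = size (grounds m 0 C).
Proof.
elim: v k => [|[] v IHv] /= k; first by case=> ->; rewrite /= size_map.
  by rewrite size_map => /IHv; rewrite addSn.
by case: k => // k /IHv; rewrite size_map.
Qed.

Lemma contactsE (m : nat) (w : seq bool) :
  level m 0 w = Some 0 -> contacts m w = (size (grounds m 0 w)).-1.
Proof.
move=> lw; have eg: perm_eq (grounds m 0 w)
    (0 :: [seq i <- iota 1 (size w) | on_line m w i]).
  apply: uniq_perm; first exact: uniq_grounds.
    rewrite /= mem_filter mem_iota andbF filter_uniq ?iota_uniq //.
  (* Position 0 is always a contact, and is the one that [contacts] omits. *)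
  move=> [|j]; rewrite mem_grounds in_cons ?take0 // mem_filter mem_iota /=.
  rewrite add1n ltnS andbC; case: leqP => //= lej; rewrite ?andbF ?andbT //.
  move: lw; rewrite -{1}(cat_take_drop j.+1 w) => /level_catP[l lj _].
  rewrite lj /on_line /hpos /vpos; move: (level_count lj).
  move: (count_mem true (take j.+1 w)) (count_mem false (take j.+1 w)) => c d.
  by rewrite add0n => ->; apply/eqP/eqP => [[->]//|e]; congr Some; lia.
by rewrite (perm_size eg) /= size_filter.
Qed.

Local Open Scope ring_scope.

(** Marking a contact at [j] keeps the contacts from [j] on; as the mark runs
    through all contacts, every number from 1 to their total occurs once. *)
Lemma sum_grounds_drop (m k : nat) (w : seq bool) :
  \sum_(j <- grounds m k w) 'X^(size (grounds m 0 (drop j w))) =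
  \sum_(r < size (grounds m k w)) 'X^(r.+1) :> {poly int}.
Proof.
elim: w k => [|b w IHw] k.
  by case: k => [|k] /=; rewrite ?big_nil ?big_ord0 // big_seq1 big_ord1.
set t := match b with true => grounds m (k + m)%N w
                    | false => if k is k'.+1 then grounds m k' w else [::] end.
have eg: grounds m k (b :: w) = nseq (k == 0%N) 0%N ++ map S t.
  by rewrite /t; case: b {t} => //; case: k => [|k].
have et: \sum_(j <- t) 'X^(size (grounds m 0 (drop j w))) =
         \sum_(r < size t) 'X^(r.+1) :> {poly int}.
  rewrite /t; case: b {t eg} => //; case: k => [|k] //=.
  by rewrite big_nil big_ord0.
rewrite eg big_cat big_map /= et size_cat size_nseq size_map.
case: eqP => [k0|_] /=; last by rewrite big_nil add0r.
by rewrite big_seq1 drop0 -k0 eg k0 /= size_map big_ord_recr /= addrC.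
Qed.

(** * Generating series of the intervals of k-ballot words *)

Definition words (N : nat) : seq (seq bool) := [seq val t | t : N.-tuple bool].

(** The size of a k-ballot word is forced by [k] and by its number [n] of
    vertical steps, so the intervals form a finite list. *)
Definition intervals (m k n : nat) : seq (seq bool * seq bool) :=
  [seq p <- [seq (w, w') | w <- words (n + (k + n * m))%N, w' <- words (n + (k + n * m))%N]
   | [&& level m k p.1 == Some 0%N, count_mem true p.1 == n & `[< rotations m p.1 p.2 >]]].

Lemma mem_words (N : nat) (w : seq bool) : (w \in words N) = (size w == N).
Proof.
apply/mapP/eqP => [[t _ ->]|<-]; first exact: size_tuple.
by exists (in_tuple w); rewrite ?mem_enum.
Qed.

Lemma mem_intervals (m k n : nat) (w w' : seq bool) :
  reflect [/\ level m k w = Some 0%N, count_mem true w = n & rotations m w w']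
          ((w, w') \in intervals m k n).
Proof.
rewrite mem_filter /=; apply: (iffP andP) => [[/and3P[/eqP-> /eqP-> /asboolP ?] _] //|].
case=> lw cw ww'; split; first by rewrite lw cw !eqxx; apply/asboolP.
have lw' := level_rotations ww' lw.
apply: allpairs_f; rewrite mem_words; apply/eqP.
  exact: level_size.
by apply: level_size; rewrite ?(count_rotations ww').
Qed.

Lemma uniq_intervals (m k n : nat) : uniq (intervals m k n).
Proof.
have uw N : uniq (words N) by rewrite map_inj_uniq ?enum_uniq //; exact: val_inj.
by apply: filter_uniq; apply: allpairs_uniq => // -[? ?] [? ?].
Qed.

(** A k-ballot word ends at level 0, so it has at least one contact; the
    exponent discards the first one, which for [k = 0] is the starting point. *)
Definition interval_series (m k : nat) : series := fun n =>
  \sum_(p <- intervals m k n) 'X^((size (grounds m k p.1)).-1).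


Lemma mballot_word_inj (m n : nat) :
  injective (fun W : mballot m n => W : seq bool).
Proof.
case=> [U bU] [V bV] /= /val_inj eUV; case: V / eUV bV => bV.
by congr MBallot; apply: bool_irrelevance.
Qed.

Lemma mballot_level (m n : nat) (W : mballot m n) :
  level m 0 W = Some 0%N /\ count_mem true W = n.
Proof.
by case: W => W /=; rewrite is_mballotE => /andP[/eqP-> /eqP->].
Qed.

Lemma mballot_of_word (m n : nat) (w : seq bool) :
  level m 0 w = Some 0%N -> count_mem true w = n ->
  exists W : mballot m n, w = W.
Proof.
move=> lw cw; have sw: size w == (n + n * m)%N by rewrite (level_size lw cw).
have bw: is_mballot m n (Tuple sw) by rewrite is_mballotE lw cw !eqxx.
by exists (MBallot bw).
Qed.

Lemma tamari_leP (m n : nat) (W1 W2 : mballot m n) :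
  reflect (rotations m W1 W2) (tamari_le W1 W2).
Proof.
apply: (iffP connectP) => [[p]|].
  elim: p W1 => [|W p IHp] W1 /= => [_ ->|/andP[rW pW] eW2].
    exact: rt1n_refl.
  exact: rt1n_trans rW (IHp W pW eW2).
move E1: (W1 : seq bool) => w1; move E2: (W2 : seq bool) => w2 w12.
elim: w12 W1 E1 E2 => [w|w w' w'' ww' _ IH] W1 E1 E2.
  by exists [::] => //=; apply: mballot_word_inj; rewrite E1.
have [lw cw] := mballot_level W1; rewrite E1 in lw cw.
have lw' := level_rotation ww' lw.
have cw' := count_rotations (rt1n_trans _ _ _ _ _ ww' (rt1n_refl _ _ _)).
have [W' eW'] := mballot_of_word lw' (etrans cw' cw).
have [p pp ep] := IH W' (esym eW') E2.
by exists (W' :: p); rewrite //= pp E1 -eW' ww'.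
Qed.

Lemma Phi_interval_series (m : nat) : Phi m = interval_series m 0.
Proof.
apply: funext => n; rewrite /Phi /interval_series.
pose f (I : mballot m n * mballot m n) := (I.1 : seq bool, I.2 : seq bool).
have inj_f : injective f.
  by case=> [U1 U2] [V1 V2] [/mballot_word_inj-> /mballot_word_inj->].
pose P := [pred I : mballot m n * mballot m n | tamari_le I.1 I.2].
rewrite (perm_big (map f (enum P))) /=; last first.
  apply: uniq_perm; first exact: uniq_intervals.
    by rewrite map_inj_uniq ?enum_uniq.
  case=> w w'; apply/mem_intervals/mapP => [[lw cw ww']|[[W W']]].
    have [W' eW'] := mballot_of_word (level_rotations ww' lw)
                                     (etrans (count_rotations ww') cw).
    have [W eW] := mballot_of_word lw cw.
    exists (W, W'); last by rewrite eW eW'.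
    by rewrite mem_enum; apply/tamari_leP; rewrite -eW -eW'.
  rewrite mem_enum => /tamari_leP WW' [-> ->].
  by have [lW cW] := mballot_level W; split.
rewrite big_map big_enum; apply: eq_bigr => [[W W'] _] /=.
by rewrite contactsE //; case: (mballot_level W).
Qed.

Lemma interval_series0 (m : nat) : interval_series m 0 0%N = 1.
Proof.
rewrite /interval_series (perm_big [:: ([::], [::])]) /=.
  by rewrite big_seq1.
apply: uniq_perm => //; first exact: uniq_intervals.
case=> w w'; rewrite inE; apply/mem_intervals/eqP => [[lw cw ww']|[-> ->]].
  have lw' := level_rotations ww' lw; have cw' := count_rotations ww'.
  rewrite cw in cw'.
  by move: (level_size lw cw) (level_size lw' cw'); case: w w' {lw cw ww' lw' cw'} => [|? ?] [].
by split=> //; apply: rt1n_refl.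
Qed.

(** The contacts of 1 w after the start are exactly those of w, first one
    included: this is where the factor x comes from. *)
Lemma interval_seriesS (m n : nat) :
  interval_series m 0 n.+1 = 'X * interval_series m m n.
Proof.
pose up (p : seq bool * seq bool) := (true :: p.1, true :: p.2).
rewrite {1}/interval_series (perm_big (map up (intervals m m n))) /=; last first.
  apply: uniq_perm; first exact: uniq_intervals.
    by rewrite map_inj_uniq ?uniq_intervals // => -[? ?] [? ?] [-> ->].
  case=> w w'; apply/mem_intervals/mapP => [[lw cw ww']|[[v v'] /mem_intervals[lv cv vv'] [-> ->]]].
    case: w lw cw ww' => [|[] v] // lw [cw] ww'.
    have lw' := level_rotations ww' lw; have cw' := count_rotations ww'.
    case: w' ww' lw' cw' => [|[] v'] // /rotations_up vv' _ _.
    by exists (v, v') => //; apply/mem_intervals; split; rewrite // -cw add1n.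
  by split; rewrite /= ?add1n ?cv //; apply/rotations_up.
rewrite big_map big_distrr /=; apply: eq_big_seq => -[v v'] /mem_intervals[lv _ _].
by rewrite /= size_map -exprS prednK // size_grounds_gt0.
Qed.

(** On monomials, Delta(x^e) = (x^(e+1) - 1) / (x - 1) = 1 + x + ... + x^e. *)
Lemma Delta_sum (T : Type) (s : nat -> seq T) (e : T -> nat) (n : nat) :
  Delta (fun i => \sum_(p <- s i) 'X^(e p)) n =
  \sum_(p <- s n) \sum_(r < (e p).+1) 'X^r.
Proof.
have X1 : 'X - 1 != 0 :> {poly int} by rewrite -polyC1 polyXsubC_eq0.
apply: (mulfI X1); rewrite DeltaE !big_distrr /= horner_sum.
rewrite [X in _ - X]rmorph_sum -sumrB; apply: eq_bigr => p _.
by rewrite hornerXn expr1n -exprS subrX1.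
Qed.

Lemma mem_dpairs (S T : eqType) (s : seq S) (t : S -> seq T) (x : S) (y : T) :
  ((x, y) \in [seq (x', y') | x' <- s, y' <- t x']) = (x \in s) && (y \in t x).
Proof.
apply/allpairsPdep/andP => [[x' [y' [? ? [-> ->]]]] //|[? ?]].
by exists x, y.
Qed.

Lemma uniq_dpairs (S T : eqType) (s : seq S) (t : S -> seq T) :
  uniq s -> (forall x, uniq (t x)) -> uniq [seq (x, y) | x <- s, y <- t x].
Proof.
by move=> us ut; apply: allpairs_uniq_dep => // -[x y] [x' y'] _ _ /= [-> ->].
Qed.

(** The data from which an interval one level higher is assembled: an interval
    [p] of ballot paths, an interval [q] of k-ballot words, and a contact [j] of
    the lower word of [q].  The size [i] of [p] is recorded to split the sum as
    in a Cauchy product. *)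
Definition gluings (m k n : nat) :=
  [seq (i, z) | i <- iota 0 n.+1,
    z <- [seq (p, y) | p <- intervals m 0 i,
      y <- [seq (q, j) | q <- intervals m k (n - i), j <- grounds m k q.1]]].

(** In the notation v, A, D of [rotations_last_descent], [q.1] is v A cut at
    [j], and [p.1] is D. *)
Definition glue (z : nat * ((seq bool * seq bool) * ((seq bool * seq bool) * nat))) :=
  let: (_, (p, (q, j))) := z in
  (take j q.1 ++ false :: drop j q.1 ++ p.1, q.2 ++ false :: p.2).

Lemma mem_gluings (m k n i : nat) (p q : seq bool * seq bool) (j : nat) :
  reflect [/\ (i <= n)%N, p \in intervals m 0 i, q \in intervals m k (n - i)
            & j \in grounds m k q.1]
          ((i, (p, (q, j))) \in gluings m k n).
Proof.
rewrite !mem_dpairs mem_iota add0n ltnS.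
by apply: (iffP and4P).
Qed.

Lemma uniq_gluings (m k n : nat) : uniq (gluings m k n).
Proof.
apply: uniq_dpairs => [|i]; first exact: iota_uniq.
apply: uniq_dpairs => [|p]; first exact: uniq_intervals.
by apply: uniq_dpairs => [|q]; [apply: uniq_intervals | apply: uniq_grounds].
Qed.

(** The assembly is reversible: the last descent of the upper word separates
    [q.2] from [p.2], that of the lower word locates [j], and [p.1] is cut off
    from the rest by its size, which is that of [p.2]. *)
Lemma intervals_gluings (m k n : nat) : (0 < m)%N ->
  perm_eq (intervals m k.+1 n) (map glue (gluings m k n)).
Proof.
move=> m0; apply: uniq_perm; first exact: uniq_intervals.
  rewrite map_inj_in_uniq ?uniq_gluings //.
  move=> [i [[p1 p2] [[q1 q2] j]]] [i' [[p1' p2'] [[q1' q2'] j']]].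
  move=> /mem_gluings[_ /mem_intervals[lp cp pp] /mem_intervals[lq _ qq]].
  rewrite mem_grounds => /andP[lej /eqP lj].
  move=> /mem_gluings[_ /mem_intervals[lp' cp' pp'] /mem_intervals[lq' _ qq']].
  rewrite mem_grounds => /andP[lej' /eqP lj'].
  case=> e1 e2.
  have [eq2 ep2] := last_descent_uniq (level_rotations qq lq) (level_rotations qq' lq') e2.
  have [et ed] := last_descent_uniq lj lj' e1.
  have sp: size p1 = size p1'.
    rewrite (level_size lp erefl) (level_size lp' erefl).
    by rewrite -(count_rotations pp) -(count_rotations pp') ep2.
  have [ed' ep1]: drop j q1 = drop j' q1' /\ p1 = p1'.
    have sd: size (drop j q1) = size (drop j' q1').
      by move/(congr1 size): ed; rewrite !size_cat sp => /addIn.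
    by move/eqP: ed; rewrite eqseq_cat // => /andP[/eqP-> /eqP->].
  have ei: i = i'.
    by rewrite -cp -cp' -(count_rotations pp) -(count_rotations pp') ep2.
  have ej: j = j' by move/(congr1 size): et; rewrite !size_takel.
  have eq1: q1 = q1' by rewrite -(cat_take_drop j q1) et ed' cat_take_drop.
  by rewrite ei ep1 ep2 eq1 eq2 ej.
case=> w w'; apply/mem_intervals/mapP => [[lw cw ww']|].
  have [v [C [ew lv lC]]] := last_descent_ex lw.
  have [v' [C' [ew' lv' lC']]] := last_descent_ex (level_rotations ww' lw).
  rewrite ew ew' in ww'.
  have [A [D [eC lA lD vA DC]]] := (rotations_last_descent C' m0 lv lC lv').1 ww'.
  exists (count_mem true D, ((D, C'), ((v ++ A, v'), size v))); last first.
    by rewrite /= take_size_cat // drop_size_cat // ew ew' eC.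
  have cn: (count_mem true (v ++ A) + count_mem true D)%N = n.
    by rewrite -cw ew eC !count_cat /= !count_cat add0n addnA.
  apply/mem_gluings; split.
  - by rewrite -cn leq_addl.
  - exact/mem_intervals.
  - by apply/mem_intervals; rewrite level_cat lv -cn addnK.
  - by rewrite mem_grounds size_cat leq_addr take_size_cat // lv eqxx.
case=> [[i [[p1 p2] [[q1 q2] j]]]].
case/mem_gluings=> lei /mem_intervals[lp cp pp] /mem_intervals[lq cq qq].
rewrite mem_grounds => /andP[_ /eqP lj] /= [-> ->].
have ld: level m 0 (drop j q1) = Some 0%N.
  by move: lq; rewrite -{1}(cat_take_drop j q1) level_cat lj.
have ldp: level m 0 (drop j q1 ++ p1) = Some 0%N by rewrite level_cat ld.
split.
- by rewrite (last_descent_level _ lj).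
- rewrite !count_cat /= count_cat add0n addnA -count_cat cat_take_drop cq cp.
  exact: subnK.
apply/(rotations_last_descent p2 m0 lj ldp (level_rotations qq lq)).
by exists (drop j q1), p1; rewrite cat_take_drop.
Qed.

(** For a fixed pair of intervals, the sum over the marked contact is the sum
    that Delta produces.  The contacts of the glued word lie after the
    separating step: those of the marked suffix, then those of [p.1], sharing
    one. *)
Lemma interval_series_descent (m k : nat) : (0 < m)%N ->
  interval_series m k.+1 = sprec (interval_series m 0) (interval_series m k).
Proof.
move=> m0; apply: funext => n.
rewrite /interval_series (perm_big _ (intervals_gluings k n m0)) big_map.
rewrite big_allpairs_dep /sprec /smul -[n.+1]subn0 -/(index_iota _ _) big_mkord subn0.
apply: eq_bigr => i _; rewrite big_allpairs_dep big_distrl /=.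
apply: eq_big_seq => -[p1 p2] /mem_intervals[lp _ _].
rewrite Delta_sum big_distrr big_allpairs_dep /=.
apply: eq_big_seq => -[q1 q2] /mem_intervals[lq _ _] /=.
rewrite prednK ?size_grounds_gt0 //.
(* [sum_grounds_drop] counts the marked contact itself, which shifts every
   exponent by one, so both sides are multiplied by x. *)
apply: (mulfI (negbT (polyX_eq0 _))).
rewrite mulrCA [in RHS]big_distrr /=.
under [in RHS]eq_bigr do rewrite -exprS.
rewrite -sum_grounds_drop !big_distrr; apply: eq_big_seq => j /=.
rewrite mem_grounds => /andP[_ /eqP lj].
have ld: level m 0 (drop j q1) = Some 0%N.
  by move: lq; rewrite -{1}(cat_take_drop j q1) level_cat lj.
rewrite (size_grounds_last_descent _ lj) -exprS -exprD; congr ('X^ _).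
have := size_grounds_cat p1 ld; have := size_grounds_gt0 ld; have := size_grounds_gt0 lp.
rewrite eqxx; move: (size (grounds m 0 (drop j q1 ++ p1))).
by move: (size (grounds m 0 p1)) (size (grounds m 0 (drop j q1))) => a b c; lia.
Qed.

Theorem theorem4p4 (m : nat) (hm : (1 <= m)%N) :
  Phi m = sadd (Bop (Phi m) [tuple Phi m | _ < m]) sone.
Proof.
have nestE k : sprec_nest (nseq k.+1 (Phi m)) = interval_series m k.
  elim: k => [|k IHk]; first by rewrite /= Phi_interval_series.
  by rewrite interval_series_descent // -IHk -Phi_interval_series.
have tE : tval [tuple Phi m | _ < m] = nseq m (Phi m).
  have mapE (s : seq 'I_m) : [seq Phi m | _ <- s] = nseq (size s) (Phi m).
    by elim: s => //= _ s ->.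
  by rewrite /= mapE size_enum_ord.
have nestm : sprec_nest (nseq m (Phi m)) = interval_series m m.-1.
  by rewrite -nestE prednK.
have seriesm : interval_series m m =
    sprec (interval_series m 0) (interval_series m m.-1).
  by rewrite -interval_series_descent // prednK.
rewrite /Bop tE nestm.
apply: funext => n; rewrite /sadd /sone /ssucc {1}Phi_interval_series.
have xyE (D : series) i : smul sxy D i = if i is i'.+1 then 'X * D i' else 0.
  rewrite /smul; case: i => [|i]; first by rewrite big_ord1 mul0r.
  rewrite big_ord_recl mul0r add0r big_ord_recl subSS subn0 big1 ?addr0 // => j _.
  by rewrite mul0r.
have prodE (D : series) i : smul (Phi m) (smul sxy D) i =
    \sum_(j < i.+1) Phi m j * smul sxy D (i - j)%N by [].
rewrite /sprec prodE; case: n => [|n].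
  by rewrite interval_series0 big_ord1 xyE mulr0 add0r.
rewrite interval_seriesS addr0 seriesm.
rewrite big_ord_recr /= subnn xyE mulr0 addr0 /sprec /smul big_distrr /=.
rewrite Phi_interval_series; apply: eq_bigr => i _.
by rewrite -/(smul sxy _ _) subSn ?xyE 1?mulrCA // -ltnS.
Qed.
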